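(* Let $1\le p<n$ be integers and let $U=\begin{pmatrix}U_1\\ U_2\end{pmatrix}$, $V=\begin{pmatrix}V_1\\ V_2\end{pmatrix}\in\mathbb{R}^{n\times p}$ with $U^TU=V^TV=I_p$, with blocks $U_1,V_1\in\mathbb{R}^{p\times p}$ invertible and $U_2,V_2\in\mathbb{R}^{(n-p)\times p}$. Let $P_U=UU^T$ and $P_V=VV^T$ be the corresponding projectors in $\mathrm{Gr}(n,p)$. Then $$\|\Psi(P_U)-\Psi(P_V)\|_{\mathrm F}\le\sqrt{\|U_1^{-1}\|_{\mathrm F}^2-p}+\sqrt{\|V_1^{-1}\|_{\mathrm F}^2-p}.$$
   Context: $\mathrm{Gr}(n,p)=\{P\in\mathbb{R}^{n\times n}\mid P^2=P,\ P^T=P,\ \operatorname{rank}P=p\}$. The coordinate chart $\Psi$ is defined on the set of those $P=\begin{pmatrix}A&\hat B^T\\ \hat B&C\end{pmatrix}\in\mathrm{Gr}(n,p)$ (with $A\in\mathbb{R}^{p\times p}$, $\hat B\in\mathbb{R}^{(n-p)\times p}$) for which the upper left block $A$ is invertible, by $\Psi(P)=\hat BA^{-1}\in\mathbb{R}^{(n-p)\times p}$. $\|\cdot\|_{\mathrm F}$ is the Frobenius norm. *)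

(* Defs.v *)
From mathcomp Require Import all_boot all_order all_algebra.
From mathcomp Require Import reals.

Set Implicit Arguments.
Unset Strict Implicit.
Unset Printing Implicit Defensive.

Import GRing.Theory Num.Theory.
Local Open Scope ring_scope.

Definition frob (R : realType) (m n : nat) (A : 'M[R]_(m, n)) : R :=
  Num.sqrt (\sum_(i < m) \sum_(j < n) A i j ^+ 2).

Definition grassmannian (R : realType) (n p : nat) : pred 'M[R]_n :=
  fun P => [&& P *m P == P, P^T == P & \rank P == p].

(* The block decomposition P = [A, B^T; B, C] is carried by the type: the
   ambient dimension is written p + q with A of size p, so that
   A = ulsubmx P and B = dlsubmx P. *)
Definition chart_domain (R : realType) (p q : nat) : pred 'M[R]_(p + q) :=
  fun P => grassmannian p P && (ulsubmx P \in unitmx).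

(* As for [invmx], the value is meaningful only on [chart_domain]. *)
Definition chart (R : realType) (p q : nat) (P : 'M[R]_(p + q)) : 'M[R]_(q, p) :=
  dlsubmx P *m invmx (ulsubmx P).

Definition projector (R : realType) (n p : nat) (U : 'M[R]_(n, p)) : 'M[R]_n :=
  U *m U^T.

Lemma projector_grassmannian (R : realType) (n p : nat) (U : 'M[R]_(n, p)) :
  U^T *m U = 1%:M -> grassmannian p (projector U).
Proof.
move=> hU; rewrite /grassmannian /projector trmx_mul trmxK eqxx /=.
rewrite mulmxA -(mulmxA U) hU mulmx1 eqxx /= eqn_leq.
rewrite (leq_trans (mxrankM_maxl _ _) (rank_leq_col _)) /=.
have hU' : U^T *m (U *m U^T *m U) = 1%:M by rewrite -mulmxA hU mulmx1.
rewrite -{1}(mxrank1 R p) -hU'.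
exact: leq_trans (mxrankM_maxr _ _) (mxrankM_maxl _ _).
Qed.

Lemma projector_chart_domain (R : realType) (p q : nat) (U : 'M[R]_(p + q, p)) :
  U^T *m U = 1%:M -> usubmx U \in unitmx -> chart_domain (projector U).
Proof.
move=> hU hU1; rewrite /chart_domain projector_grassmannian //= /projector.
rewrite -[U]vsubmxK tr_col_mx mul_col_row block_mxKul.
by rewrite unitmx_mul unitmx_tr hU1.
Qed.

(* Main.v *)
(* The chart sends U U^T to U2 U1^-1, and U1^T U1 + U2^T U2 = 1 turns
   the squared norm tr ((U2 U1^-1)^T (U2 U1^-1)) into |U1^-1|^2 - p. So each
   square root is the norm of one of the two chart values, and the bound is the
   triangle inequality. *)
Require Import Defs.
From mathcomp Require Import all_boot all_order all_algebra.
From mathcomp Require Import reals.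
From mathcomp Require Import ring.
Import GRing.Theory Num.Theory.
Local Open Scope ring_scope.

Lemma frob_ge0 (R : realType) (m n : nat) (A : 'M[R]_(m, n)) : 0 <= frob A.
Proof. exact: sqrtr_ge0. Qed.

Lemma sqr_frob_sum (R : realType) (m n : nat) (A : 'M[R]_(m, n)) :
  frob A ^+ 2 = \sum_(i < m) \sum_(j < n) A i j ^+ 2.
Proof.
by rewrite sqr_sqrtr // !sumr_ge0 // => i _; apply: sumr_ge0 => j _; apply: sqr_ge0.
Qed.

Lemma sqr_frob (R : realType) (m n : nat) (A : 'M[R]_(m, n)) :
  frob A ^+ 2 = \tr (A^T *m A).
Proof.
rewrite sqr_frob_sum exchange_big; apply: eq_bigr => j _.
by rewrite mxE; apply: eq_bigr => i _; rewrite mxE expr2.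
Qed.

Lemma frob_eq0 (R : realType) (m n : nat) (A : 'M[R]_(m, n)) :
  frob A = 0 -> A = 0.
Proof.
move=> A0; have /eqP := sqr_frob_sum R m n A; rewrite A0 expr0n /= eq_sym.
rewrite psumr_eq0 => [/allP A0i|i _]; last by apply: sumr_ge0 => j _; apply: sqr_ge0.
apply/matrixP => i j; rewrite mxE; move: (A0i i (mem_index_enum i)) => /=.
rewrite psumr_eq0 => [/allP/(_ j (mem_index_enum j))|k _]; last exact: sqr_ge0.
by rewrite /= sqrf_eq0 => /eqP.
Qed.

(** The scalars are kept general because two choices are used later: [frob B] and [- frob A] for
    Cauchy-Schwarz, 1 and -1 for the triangle inequality. *)
Lemma sqr_frobZD (R : realType) (m n : nat) (a b : R) (A B : 'M[R]_(m, n)) :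
  frob (a *: A + b *: B) ^+ 2 =
    a ^+ 2 * frob A ^+ 2 + b ^+ 2 * frob B ^+ 2 + 2 * (a * b) * \tr (A^T *m B).
Proof.
have trC : \tr (B^T *m A) = \tr (A^T *m B).
  by rewrite -mxtrace_tr trmx_mul trmxK.
rewrite !sqr_frob [(_ + _)^T]linearD /= ![(_ *: _)^T]linearZ /=.
rewrite mulmxDl !mulmxDr -!scalemxAl -!scalemxAr !mxtraceD !mxtraceZ trC; ring.
Qed.

Lemma frob_cauchy_schwarz (R : realType) (m n : nat) (A B : 'M[R]_(m, n)) :
  \tr (A^T *m B) <= frob A * frob B.
Proof.
(* A zero norm forces a zero matrix, and both sides vanish. Setting these cases aside makes
   [frob A * frob B] positive, so that it can be cancelled below. *)
have [A0|A0] := eqVneq (frob A) 0.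
  by rewrite A0 (frob_eq0 _ _ _ _ A0) trmx0 mul0mx mxtrace0 mul0r.
have [B0|B0] := eqVneq (frob B) 0.
  by rewrite B0 (frob_eq0 _ _ _ _ B0) mulmx0 mxtrace0 mulr0.
have AB_gt0 : 0 < frob A * frob B by rewrite mulr_gt0 // lt0r ?A0 ?B0 frob_ge0.
(* Both scaled matrices have norm [frob A * frob B], so the squared norm of their difference has
   this product as a factor; the other factor is twice the Cauchy-Schwarz gap. *)
have := sqr_ge0 (frob (frob B *: A + (- frob A) *: B)).
suff -> : frob (frob B *: A + (- frob A) *: B) ^+ 2 =
    2 * (frob A * frob B * (frob A * frob B - \tr (A^T *m B))).
  by rewrite pmulr_rge0 ?ltr0n // pmulr_rge0 // subr_ge0.
by rewrite sqr_frobZD; ring.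
Qed.

Lemma frobB_le (R : realType) (m n : nat) (A B : 'M[R]_(m, n)) :
  frob (A - B) <= frob A + frob B.
Proof.
rewrite -(@ler_pXn2r _ 2) ?nnegrE ?addr_ge0 ?frob_ge0 // -subr_ge0.
(* After squaring, the cross term of [A - B] carries a minus sign, so Cauchy-Schwarz is applied to
   [- A] and [B]. *)
have trN : - \tr (A^T *m B) <= frob A * frob B.
  have frobN : frob (- A) = frob A.
    congr Num.sqrt; apply: eq_bigr => i _; apply: eq_bigr => j _.
    by rewrite mxE sqrrN.
  by have := frob_cauchy_schwarz R m n (- A) B; rewrite frobN !raddfN /= mulNmx raddfN.
suff -> : (frob A + frob B) ^+ 2 - frob (A - B) ^+ 2 =
    2 * (frob A * frob B - - \tr (A^T *m B)).
  by rewrite pmulr_rge0 ?ltr0n // subr_ge0.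
by rewrite -[A in A - B]scale1r -[- B]scaleN1r sqr_frobZD; ring.
Qed.

(** The left blocks of $UU^T$ are $U_1U_1^T$ and $U_2U_1^T$, so the common right factor $U_1^T$
    cancels in the quotient. *)
Lemma chart_projector (R : realType) (p q : nat) (U : 'M[R]_(p + q, p)) :
  usubmx U \in unitmx ->
  chart (projector U) = dsubmx U *m invmx (usubmx U).
Proof.
move=> U1; rewrite /chart.
have -> : projector U = col_mx (usubmx U) (dsubmx U) *m
    row_mx (usubmx U)^T (dsubmx U)^T by rewrite -tr_col_mx vsubmxK.
rewrite mul_col_row block_mxKul block_mxKdl.
have U1T : (usubmx U)^T \in unitmx by rewrite unitmx_tr.
apply: (canLR (mulmxK _)); first by rewrite unitmx_mul U1.
by rewrite mulmxA mulmxKV.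
Qed.

Lemma frob_chart_projector (R : realType) (p q : nat) (U : 'M[R]_(p + q, p)) :
  U^T *m U = 1%:M -> usubmx U \in unitmx ->
  frob (chart (projector U)) = Num.sqrt (frob (invmx (usubmx U)) ^+ 2 - p%:R).
Proof.
move=> UTU U1; rewrite chart_projector //.
(* Writing the left side as the root of its square leaves an equality of radicands, with no sign
   condition on the right one. *)
rewrite -[LHS]ger0_norm ?frob_ge0 // -sqrtr_sqr; congr Num.sqrt.
have UTU2 : (dsubmx U)^T *m dsubmx U = 1%:M - (usubmx U)^T *m usubmx U.
  by rewrite -UTU -{3 4}[U]vsubmxK tr_col_mx mul_row_col addrC addKr.
rewrite !sqr_frob trmx_mul mulmxA -(mulmxA _ _ (dsubmx U)) UTU2.
(* The subtracted term regroups as $(U_1U_1^{-1})^T(U_1U_1^{-1})=I_p$, whose trace is $p$. *)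
rewrite mulmxBr mulmx1 mulmxBl raddfB /= !mulmxA -trmx_mul.
by rewrite mulmxV // trmx1 mul1mx mulmxV // mxtrace1.
Qed.

Theorem lemma3 (R : realType) (n p : nat) (hp : (1 <= p)%N) (hpn : (p < n)%N)
    (U V : 'M[R]_(p + (n - p), p))
    (hU : U^T *m U = 1%:M) (hV : V^T *m V = 1%:M)
    (hU1 : usubmx U \in unitmx) (hV1 : usubmx V \in unitmx) :
  frob (chart (projector U) - chart (projector V)) <=
    Num.sqrt (frob (invmx (usubmx U)) ^+ 2 - p%:R) +
    Num.sqrt (frob (invmx (usubmx V)) ^+ 2 - p%:R).
Proof.
by rewrite -!frob_chart_projector //; apply: frobB_le.
Qed.
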